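(* Let $p$ be a prime, let $1\le U,V<p$ be integers, let ${\mathfrak C}\subseteq[1,U]\times[1,V]$ be a convex set, and let $\{\alpha_u\}_{u=1}^U$, $\{\beta_v\}_{v=1}^V$ be complex numbers with $|\alpha_u|,|\beta_v|\le 1$. For $(a,b)\in{\mathbb F}_p^*\times{\mathbb F}_p$ define $$K_{a,b}({\mathcal A},{\mathcal B};{\mathfrak C})=\sum_{(u,v)\in{\mathfrak C}}\alpha_u\beta_v\,{\mathbf e}_p\big(v/(au+b)\big),$$ where the sum is over integer points $(u,v)\in{\mathfrak C}$ with $au+b\not\equiv0\pmod p$. Then, uniformly over $(a,b)\in{\mathbb F}_p^*\times{\mathbb F}_p$ and over $U,V,{\mathfrak C}$ and the weights, as $p\to\infty$, $$|K_{a,b}({\mathcal A},{\mathcal B};{\mathfrak C})|\le UV^{1/2}p^{1/3+o(1)}+U^{1/2}Vp^{o(1)}.$$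
   Context: ${\mathbf e}_p(z)=\exp(2\pi i z/p)$, where $v/(au+b)$ denotes an element of ${\mathbb F}_p$ represented by an integer in $\{0,\dots,p-1\}$. The notation $p^{o(1)}$ denotes a factor $p^{\epsilon(p)}$ with $\epsilon(p)\to0$ as $p\to\infty$. *)

(* Defs.v *)
From HB Require Import structures.
From mathcomp Require Export all_boot all_order all_algebra.
From mathcomp Require Export all_classical all_reals all_analysis.
From mathcomp Require Export complex.

Set Implicit Arguments.
Unset Strict Implicit.
Unset Printing Implicit Defensive.

Import Order.TTheory GRing.Theory Num.Theory.
Import numFieldNormedType.Exports.

Local Open Scope classical_set_scope.
Local Open Scope ring_scope.
Local Open Scope complex_scope.

(* exp (x + i y) = exp x * (cos y + i sin y) *)
Definition cexp (R : realType) (z : R[i]) : R[i] :=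
  (expR (complex.Re z))%:C *
  (cos (complex.Im z) +i* sin (complex.Im z)).

Definition ep (R : realType) (p : nat) (z : R) : R[i] :=
  cexp (0 +i* (2 * pi * z / p%:R)).

(* v / (a u + b) is computed in 'F_p; its representative in {0, ..., p - 1}
   is the underlying natural number of the ordinal, embedded into R.
   The nat interval sums capture every integer point of C as soon as
   C is included in [1, U] x [1, V]. *)
Definition kloosterman_sum (R : realType) (p U V : nat) (a b : 'F_p)
    (C : set (R^o * R^o)) (alpha beta : nat -> R[i]) : R[i] :=
  \sum_(1 <= u < U.+1)
    \sum_(1 <= v < V.+1 | ((u%:R, v%:R) \in C) && (a * u%:R + b != 0))
      alpha u * beta v *
      ep p ((nat_of_ord ((v%:R : 'F_p) / (a * u%:R + b)))%:R : R).

(* Main.v *)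
(* Write f(u) = 1 / (a u + b) and let Z be about p / V. Cauchy-Schwarz over v
   bounds |K|^2 by V times a sum over pairs (u1, u2) of exponential sums over
   the v with (u1, v) and (u2, v) in C; by convexity these v form an interval,
   so each sum is O(V / (j + 1)) when f(u1) - f(u2) lies in the j-th arc of
   length Z on either side of 0 modulo p.

   It remains to count the u with f(u) in a given arc. Cut [1, U] into blocks of
   length M. In one block the pairs (u, f(u)) are points of a modular hyperbola
   in an M x Z box; since 6 (M Z)^2 < p, a determinant argument lifts the
   congruence to an integral equation (A x + C)(A y + B) = B C with
   0 < |B C| <= (M Z)^3, so the divisor bound gives p^o(1) points per block.
   With M about V / p^(2/3) an arc contains (1 + U p^(2/3) / V) p^o(1) of the
   f(u), which is the claimed estimate squared. *)
Require Import Defs.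
From mathcomp Require Import zify ring lra.

Set Implicit Arguments.
Unset Strict Implicit.
Unset Printing Implicit Defensive.

Import Order.TTheory GRing.Theory Num.Theory.
Import numFieldNormedType.Exports.

Local Open Scope classical_set_scope.
Local Open Scope ring_scope.
Local Open Scope complex_scope.

(** * The divisor bound *)

(** Every divisor of [q ^ e * m] splits as [q ^ i * d] with [i <= e] and [d] dividing [m]. *)
Lemma size_divisors_pfactor (q e m : nat) : prime q -> (0 < m)%N ->
  coprime q m ->
  (size (divisors (q ^ e * m)) <= e.+1 * size (divisors m))%N.
Proof.
move=> qP m0 qm.
have q0 : (0 < q)%N := prime_gt0 qP.
have N0 : (0 < q ^ e * m)%N by rewrite muln_gt0 expn_gt0 q0.
have le : (size (divisors (q ^ e * m)) <=
   size [seq (q ^ i * d)%N | i <- iota 0 e.+1, d <- divisors m])%N.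
  apply: uniq_leq_size; first exact: divisors_uniq.
  move=> x; rewrite -dvdn_divisors// => xN.
  have x0 : (0 < x)%N by apply: dvdn_gt0 xN.
  have [k kx xE] := pfactor_coprime qP x0.
  apply/allpairsP; exists (logn q x, k); split => //=.
  - rewrite -[_ \in _]/(logn q x \in iota 0 e.+1) mem_iota add0n ltnS /=.
    have := dvdn_leq_log q N0 xN.
    rewrite lognM ?expn_gt0 ?q0// pfactorK//.
    suff -> : logn q m = 0%N by rewrite addn0.
    by rewrite logn_coprime.
  - rewrite -dvdn_divisors//.
    have : (k %| q ^ e * m)%N by apply: dvdn_trans xN; rewrite xE dvdn_mulr.
    by rewrite Gauss_dvdr// coprimeXr// coprime_sym.
  - by rewrite mulnC.
by apply: leq_trans le _; rewrite size_allpairs size_iota.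
Qed.

(** Large primes cost no constant in the divisor bound: e + 1 <= 2^e <= (q^d)^e. *)
Lemma succ_le_powR (R : realType) (d : R) (q e : nat) : 0 < d ->
  2 <= q%:R `^ d -> e.+1%:R <= (q ^ e)%N%:R `^ d.
Proof.
move=> d0 q2; rewrite natrX -powR_mulrn// powRAC powR_mulrn ?powR_ge0//.
apply: (@le_trans _ _ (2 ^+ e)); last first.
  by apply: lerXn2r => //; rewrite nnegrE ?powR_ge0.
by rewrite -natrX ler_nat ltn_expl.
Qed.

(** The cost of a small prime: q^(e d) >= 2^(e d) >= 1 + e d ln 2, and multiplying the right side by
    1 + 1/(d ln 2) gives at least 1 + e. *)
Lemma succ_le_mul_powR (R : realType) (d : R) (q e : nat) : 0 < d ->
  (2 <= q)%N -> e.+1%:R <= (1 + (d * ln 2)^-1) * (q ^ e)%N%:R `^ d.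
Proof.
move=> d0 q2.
have l2 : 0 < ln 2 :> R by apply: ln_gt0; rewrite ltr1n.
have dl : 0 < d * ln 2 by rewrite mulr_gt0.
have lb : 1 + d * ln 2 * e%:R <= (q ^ e)%N%:R `^ d.
  apply: (@le_trans _ _ ((2 ^ e)%N%:R `^ d)).
    rewrite /powR pnatr_eq0 expn_eq0/= natrX lnXn ?ltr0n//.
    by rewrite -mulrA mulr_natr; apply: expR_ge1Dx.
  apply: ge0_ler_powR; rewrite ?nnegrE ?(ltW d0)// ler_nat.
  by case: (e) => // k; rewrite leq_exp2r.
apply: le_trans (ler_wpM2l _ lb); last by rewrite addr_ge0// invr_ge0 ltW.
rewrite mulrDr mulr1 mulrDl mul1r mulrA mulVf ?gt_eqF// mul1r -natr1.
have e0 : 0 <= d * ln 2 * e%:R by rewrite mulr_ge0// ltW.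
have i0 : 0 <= (d * ln 2)^-1 by rewrite invr_ge0 ltW.
lra.
Qed.

Lemma size_divisors_le (R : realType) (d : R) : 0 < d ->
  exists2 c : R, 0 < c &
    forall n, (0 < n)%N -> (size (divisors n))%:R <= c * n%:R `^ d.
Proof.
move=> d0.
(* An integer above 2^(1/d), so that q^d >= 2 as soon as [B <= q]. *)
pose B := (Num.truncn ((2 : R) `^ d^-1)).+1.
have hB q : (B <= q)%N -> 2 <= (q%:R : R) `^ d.
  move=> Bq; have E : (2 : R) = (2 `^ d^-1) `^ d.
    by rewrite -powRrM mulVf ?lt0r_neq0// powRr1.
  rewrite [leLHS]E.
  apply: ge0_ler_powR; rewrite ?nnegrE ?(ltW d0) ?powR_ge0 ?ler0n//.
  apply: (@le_trans _ _ (B%:R : R)); last by rewrite ler_nat.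
  by apply/ltW; exact: truncnS_gt.
set c : R := 1 + (d * ln 2)^-1.
have c1 : 1 <= c.
  by rewrite lerDl invr_ge0 mulr_ge0 ?(ltW d0)// ln_ge0// ler1n.
have c0 : 0 < c := lt_le_trans ltr01 c1.
(* Peeling off the least prime factor [q]; only primes below [B] cost a
   factor [c]. *)
have key n : forall b, (0 < n)%N ->
    (forall q, prime q -> (q %| n)%N -> (b <= q)%N) ->
    (size (divisors n))%:R <= c ^+ (B - b) * n%:R `^ d.
  elim/ltn_ind: n => n IH b n0 hb.
  have [n1|n1] := leqP n 1%N.
    have -> : n = 1%N by lia.
    by rewrite powR1 mulr1 exprn_ege1.
  set q := pdiv n.
  have qP : prime q by apply: pdiv_prime.
  have [m qm nE] := pfactor_coprime qP n0.
  have m0 : (0 < m)%N by move: n0; rewrite nE muln_gt0 => /andP[].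
  have e0 : (0 < logn q n)%N by rewrite logn_gt0 mem_primes qP n0 pdiv_dvd.
  have q1 := prime_gt1 qP.
  have bq : (b <= q)%N by apply: hb; rewrite ?pdiv_dvd.
  set e := logn q n in nE e0 *.
  have mn : (m < n)%N.
    rewrite nE -{1}[m]muln1 ltn_pmul2l//.
    by apply: leq_trans (_ : q ^ 1 <= _)%N => //; rewrite leq_pexp2l// ltnW.
  (* As [q] is the least prime factor of [n] and is coprime to [m], all prime factors of [m] exceed
     [q]. *)
  have IHm := IH _ mn q.+1 m0.
  have {}IHm : (size (divisors m))%:R <= c ^+ (B - q.+1) * m%:R `^ d.
    apply: IHm => r rP rm; rewrite ltn_neqAle; apply/andP; split.
      apply: contraTneq rm => <-; rewrite -prime_coprime//.
    apply: pdiv_min_dvd; first exact: prime_gt1.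
    by rewrite nE dvdn_mulr.
  have step : (size (divisors n))%:R <=
     (e.+1%:R : R) * (size (divisors m))%:R.
    by rewrite -natrM ler_nat {1}nE mulnC size_divisors_pfactor.
  apply: le_trans step _.
  apply: le_trans (ler_wpM2l _ IHm) _ => //.
  rewrite nE natrM powRM// [m%:R `^ d * _]mulrC.
  have [Bq|qB] := leqP B q.
    have -> : (B - q.+1 = 0)%N by lia.
    rewrite expr0 mul1r.
    apply: (@le_trans _ _ ((q ^ e)%N%:R `^ d * m%:R `^ d)).
      by rewrite ler_wpM2r ?powR_ge0// succ_le_powR// hB.
    by rewrite ler_peMl ?exprn_ege1// mulr_ge0 ?powR_ge0.
  apply: (@le_trans _ _ (c ^+ (B - q) * ((q ^ e)%N%:R `^ d * m%:R `^ d))).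
    have -> : (B - q = (B - q.+1).+1)%N by lia.
    rewrite exprS.
    rewrite (_ : c * _ * _ = c * (q ^ e)%N%:R `^ d * (c ^+ (B - q.+1) * m%:R `^ d)).
      by rewrite ler_wpM2r ?mulr_ge0 ?exprn_ge0 ?powR_ge0 ?(ltW c0)// succ_le_mul_powR.
    by rewrite [RHS]mulrACA.
  rewrite ler_wpM2r ?mulr_ge0 ?powR_ge0//.
  by rewrite ler_weXn2l//; lia.
exists (c ^+ B); first exact: exprn_gt0.
by move=> n n0; have := key n 0%N n0; rewrite subn0; apply.
Qed.

(** * Points of a modular hyperbola in a small box *)

Lemma Fp_int_eq0 (p : nat) (z : int) : prime p ->
  z%:~R = 0 :> 'F_p -> (`|z| < p)%N -> z = 0.
Proof.
move=> pP z0 zp; apply/eqP; rewrite -absz_eq0; apply/eqP.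
have a0 : (`|z|%N)%:R = 0 :> 'F_p.
  rewrite pmulrn; have [z1|z1] := lerP 0 z; first by rewrite gez0_abs.
  by rewrite ltz0_abs// mulrNz z0 oppr0.
have /eqP := a0; rewrite -(dvdn_pcharf (pchar_Fp pP)) => /dvdn_leq.
by case: (posnP `|z|%N) => // z1 /(_ isT); lia.
Qed.

(** An integer is determined by its absolute value and its sign; the sign accounts for the factor
    2. *)
Lemma size_le_int_divisors (T : eqType) (s : seq T) (f : T -> int) (N : int) :
  N != 0 -> uniq s -> {in s &, injective f} ->
  {in s, forall x, (f x %| N)%Z} -> (size s <= 2 * size (divisors `|N|))%N.
Proof.
move=> N0 us fi fN.
pose g x := (`|f x|%N, f x < 0).
have gi : {in s &, injective g}.
  move=> x y xs ys [e1 e2]; apply: fi => //.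
  by rewrite (intEsign (f x)) (intEsign (f y)) e1 e2.
have -> : size s = size (map g s) by rewrite size_map.
have -> : (2 * size (divisors `|N|) =
  size [seq (d, e) | d <- divisors `|N|, e <- [:: false; true]])%N.
  by rewrite size_allpairs mulnC.
apply: uniq_leq_size; first by rewrite map_inj_in_uniq.
move=> _ /mapP[x xs ->]; apply/allpairsP; exists (g x); split.
- by rewrite -dvdn_divisors ?absz_gt0//; have := fN x xs; rewrite dvdzE.
- by rewrite /g; case: (f x < 0); rewrite !inE.
- by case: (g x).
Qed.

(* Three points of the conic [x y + T x + S y = 0] other than the origin give
   a vanishing 3 x 3 determinant modulo [p], which is too small not to vanish
   over the integers. *)
Lemma conic_lift (p m z : nat) (T S : 'F_p) (x1 y1 x2 y2 x y : int) :
  prime p -> (6 * (m * z) ^ 2 < p)%N ->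
  [/\ `|x1| <= m%:Z, `|x2| <= m%:Z & `|x| <= m%:Z] ->
  [/\ `|y1| <= z%:Z, `|y2| <= z%:Z & `|y| <= z%:Z] ->
  x1%:~R * y1%:~R + T * x1%:~R + S * y1%:~R = 0 ->
  x2%:~R * y2%:~R + T * x2%:~R + S * y2%:~R = 0 ->
  x%:~R * y%:~R + T * x%:~R + S * y%:~R = 0 ->
  (x1 * y2 - x2 * y1) * x * y + y1 * y2 * (x2 - x1) * x
    + x1 * x2 * (y1 - y2) * y = 0.
Proof.
move=> pP mzp [X1 X2 X] [Y1 Y2 Y] r1 r2 r3.
apply: (Fp_int_eq0 pP).
  rewrite !(intrD, intrM, rmorphB, intrB).
  set a1 := x1%:~R in r1 *; set a2 := x2%:~R in r2 *; set a := x%:~R in r3 *.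
  set b1 := y1%:~R in r1 *; set b2 := y2%:~R in r2 *; set b := y%:~R in r3 *.
  (* Cofactor expansion: weighting the three relations by these 2 x 2 minors eliminates [T] and
     [S]. *)
  transitivity ((a1 * b1 + T * a1 + S * b1) * (a2 * b - b2 * a)
     - (a2 * b2 + T * a2 + S * b2) * (a1 * b - b1 * a)
     + (a * b + T * a + S * b) * (a1 * b2 - b1 * a2)); first by ring.
  by rewrite r1 r2 r3 !mul0r subr0 addr0.
rewrite -ltz_nat abszE.
(* The determinant has six monomials, each made of two abscissae and two ordinates. *)
apply: (@le_lt_trans _ _ (6 * (m%:Z * z%:Z) ^+ 2)); last first.
  by rewrite -PoszM -[X in 6 * X]PoszM ltz_nat; lia.
have mon (a b c d : int) : `|a| <= m%:Z -> `|b| <= z%:Z -> `|c| <= m%:Z ->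
    `|d| <= z%:Z -> `|a * b * c * d| <= (m%:Z * z%:Z) ^+ 2.
  move=> ha hb hc hd; rewrite !normrM expr2 -!mulrA.
  by do !(apply: ler_pM; rewrite ?mulr_ge0//).
have -> : (x1 * y2 - x2 * y1) * x * y + y1 * y2 * (x2 - x1) * x
    + x1 * x2 * (y1 - y2) * y =
   x1 * y2 * x * y + - (x2 * y1 * x * y) + x2 * y1 * x * y2 +
   - (x1 * y1 * x * y2) + x1 * y1 * x2 * y + - (x1 * y2 * x2 * y) by ring.
have := mon _ _ _ _ X1 Y2 X Y. have := mon _ _ _ _ X2 Y1 X Y.
have := mon _ _ _ _ X2 Y1 X Y2. have := mon _ _ _ _ X1 Y1 X Y2.
have := mon _ _ _ _ X1 Y1 X2 Y. have := mon _ _ _ _ X1 Y2 X2 Y.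
rewrite !ler_norml => /andP[? ?] /andP[? ?] /andP[? ?] /andP[? ?] /andP[? ?].
move=> /andP[? ?]; lra.
Qed.

(** The points lie in one cell of an [m] by [z] grid. With [P0] as origin, two further points [P1]
    and [P2] supply integral coefficients [A], [B], [C] of a conic through all of them, and each
    point then yields a divisor of the fixed nonzero integer [B * C]. *)
Lemma modular_hyperbola_box (p m z i j D : nat) (S T l : 'F_p)
    (s : seq (nat * nat)) :
  prime p -> (0 < m)%N -> (0 < z)%N -> (6 * (m * z) ^ 2 < p)%N -> l != 0 ->
  (forall n, (0 < n <= (m * z) ^ 3)%N -> (size (divisors n) <= D)%N) ->
  uniq s ->
  {in s, forall P, [/\ (P.1 %/ m)%N = i, (P.2 %/ z)%N = j &
                      (P.1%:R + S) * (P.2%:R + T) = l]} ->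
  (size s <= 2 * D)%N.
Proof.
move=> pP m0 z0 mzp l0 hD us hs.
have D1 : (0 < D)%N.
  by apply: leq_trans (hD 1%N _); rewrite // expn_gt0 muln_gt0 m0 z0.
(* At most two points are covered by [D >= 1], so three distinct points may be named. *)
case: s us hs => [//|P0 [|P1 s]] us hs; first by move=> /=; lia.
case: s us hs => [|P2 s] us hs; first by move=> /=; lia.
set ss := P0 :: _ in us hs *.
have In0 : P0 \in ss by rewrite !inE eqxx.
have In1 : P1 \in ss by rewrite !inE eqxx orbT.
have In2 : P2 \in ss by rewrite !inE eqxx !orbT.
pose X (P : nat * nat) : int := P.1%:Z - P0.1%:Z.
pose Y (P : nat * nat) : int := P.2%:Z - P0.2%:Z.
have small (k u v q : nat) : (0 < k)%N -> (u %/ k)%N = q -> (v %/ k)%N = q ->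
    `|u%:Z - v%:Z| < k%:Z.
  move=> k0 hu hv; have := divn_eq u k; have := divn_eq v k.
  have := ltn_pmod u k0; have := ltn_pmod v k0; rewrite hu hv.
  set qk := (q * k)%N; lia.
have mz1 : (0 < m * z)%N by rewrite muln_gt0 m0.
have mp : (m < p)%N by nia.
have zp : (z < p)%N by nia.
have eq_small (k u v q : nat) : (0 < k < p)%N -> (u %/ k)%N = q -> (v %/ k)%N = q ->
    u%:R = v%:R :> 'F_p -> u = v.
  move=> /andP[k0 kp] hu hv uv; have := small _ _ _ _ k0 hu hv.
  have : u%:Z - v%:Z = 0.
    apply: (Fp_int_eq0 pP); first by rewrite rmorphB /= -!pmulrn uv subrr.
    have := small _ _ _ _ k0 hu hv; lia.
  lia.
(* Since [l != 0] the first factor is invertible, so it fixes the second coordinate modulo [p], and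
   a cell is shorter than [p]. *)
have Xinj P Q : P \in ss -> Q \in ss -> P.1 = Q.1 -> P = Q.
  move=> /hs[P1i P2j PE] /hs[Q1i Q2j QE] PQ.
  have PS0 : P.1%:R + S != 0.
    by apply: contraNneq l0 => E; rewrite -PE E mul0r.
  suff : P.2 = Q.2 by move: PQ; case: (P) (Q) => ? ? [? ?] /= -> ->.
  apply: (eq_small z _ _ j); rewrite ?z0//.
  by move: QE; rewrite -PE -PQ => /(mulfI PS0)/addIr ->.
have Yinj P Q : P \in ss -> Q \in ss -> P.2 = Q.2 -> P = Q.
  move=> /hs[P1i P2j PE] /hs[Q1i Q2j QE] PQ.
  have PT0 : P.2%:R + T != 0.
    by apply: contraNneq l0 => E; rewrite -PE E mulr0.
  suff : P.1 = Q.1 by move: PQ; case: (P) (Q) => ? ? [? ?] /= -> ->.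
  apply: (eq_small m _ _ i); rewrite ?m0//.
  by move: QE; rewrite -PE -PQ => /(mulIf PT0)/addIr ->.
have bX P : P \in ss -> `|X P| <= m%:Z.
  by move=> /hs[h _ _]; apply/ltW/(small _ _ _ i) => //; case: (hs _ In0).
have bY P : P \in ss -> `|Y P| <= z%:Z.
  by move=> /hs[_ h _]; apply/ltW/(small _ _ _ j) => //; case: (hs _ In0).
(* Coefficients of the hyperbola after moving [P0] to the origin, where the constant term
   cancels. *)
pose T0 := P0.2%:R + T; pose S0 := P0.1%:R + S.
have rel P : P \in ss ->
    (X P)%:~R * (Y P)%:~R + T0 * (X P)%:~R + S0 * (Y P)%:~R = 0.
  move=> /hs[_ _ PE]; have [_ _ PE0] := hs _ In0.
  rewrite /X /Y /S0 /T0 !rmorphB /=.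
  transitivity ((P.1%:R + S) * (P.2%:R + T) - (P0.1%:R + S) * (P0.2%:R + T)).
    by rewrite -!pmulrn; ring.
  by rewrite PE PE0 subrr.
have /and3P[] : uniq [:: P0; P1; P2].
  by move: us; rewrite /ss /= !inE !negb_or => /and4P[] /and3P[-> ->] _ /andP[-> _] _ _.
rewrite !inE negb_or => /andP[n01 n02] n12 _.
have zinj (u v : nat) : u%:Z - v%:Z = 0 -> u = v by lia.
have X1 : X P1 != 0.
  apply: contraNneq n01 => E; apply/eqP/esym; apply: Xinj => //; exact: zinj.
have X2 : X P2 != 0.
  apply: contraNneq n02 => E; apply/eqP/esym; apply: Xinj => //; exact: zinj.
have Y1 : Y P1 != 0.
  apply: contraNneq n01 => E; apply/eqP/esym; apply: Yinj => //; exact: zinj.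
have Y2 : Y P2 != 0.
  apply: contraNneq n02 => E; apply/eqP/esym; apply: Yinj => //; exact: zinj.
have X12 : X P1 - X P2 != 0.
  apply: contraNneq n12 => E; apply/eqP; apply: Xinj => //; apply: zinj.
  by rewrite -E /X; ring.
have Y12 : Y P1 - Y P2 != 0.
  apply: contraNneq n12 => E; apply/eqP; apply: Yinj => //; apply: zinj.
  by rewrite -E /Y; ring.
set x1 := X P1 in X1 X12 *; set x2 := X P2 in X2 X12 *.
set y1 := Y P1 in Y1 Y12 *; set y2 := Y P2 in Y2 Y12 *.
have [bx1 bx2 by1 by2] : [/\ `|x1| <= m%:Z, `|x2| <= m%:Z, `|y1| <= z%:Z
   & `|y2| <= z%:Z] by split; [apply: bX|apply: bX|apply: bY|apply: bY].
(* [P1] and [P2] share a cell, which gives [z] here instead of the 2 z of the triangle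
   inequality. *)
have by12 : `|y1 - y2| < z%:Z.
  have -> : y1 - y2 = P1.2%:Z - P2.2%:Z by rewrite /y1 /y2 /Y; ring.
  by apply: (small _ _ _ j) => //; [case: (hs _ In1)|case: (hs _ In2)].
have bx12 : `|x1 - x2| < m%:Z.
  have -> : x1 - x2 = P1.1%:Z - P2.1%:Z by rewrite /x1 /x2 /X; ring.
  by apply: (small _ _ _ i) => //; [case: (hs _ In1)|case: (hs _ In2)].
have r1 := rel _ In1; have r2 := rel _ In2.
rewrite -/x1 -/y1 in r1; rewrite -/x2 -/y2 in r2.
pose A := x1 * y2 - x2 * y1.
(* A line through the origin meets the conic in at most one other point. *)
have A0 : A != 0.
  apply/eqP => A0.
  have nz (t : int) : t != 0 -> `|t| < p%:Z -> t%:~R != 0 :> 'F_p.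
    move=> tn tp; apply: contraNneq tn => E.
    by apply/eqP; apply: (Fp_int_eq0 pP E); lia.
  have /eqP : x1%:~R * x2%:~R * (y1 - y2)%:~R = 0 :> 'F_p.
    have A0p : x1%:~R * y2%:~R - x2%:~R * y1%:~R = 0 :> 'F_p.
      by rewrite -!intrM -rmorphB /= -/A A0.
    rewrite [(y1 - y2)%:~R]rmorphB /=.
    move: A0p r1 r2; set a1 := x1%:~R; set a2 := x2%:~R.
    set b1 := y1%:~R; set b2 := y2%:~R => A0p r1 r2.
    transitivity (a2 * (a1 * b1 + T0 * a1 + S0 * b1)
       - a1 * (a2 * b2 + T0 * a2 + S0 * b2) + S0 * (a1 * b2 - a2 * b1)).
      by ring.
    by rewrite r1 r2 A0p !mulr0 subr0 addr0.
  have mpz : m%:Z < p%:Z by [].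
  have zpz : z%:Z < p%:Z by [].
  rewrite !mulf_eq0 (negbTE (nz _ X1 (le_lt_trans bx1 mpz))).
  rewrite (negbTE (nz _ X2 (le_lt_trans bx2 mpz))).
  by rewrite (negbTE (nz _ Y12 (lt_trans by12 zpz))).
pose B := y1 * y2 * (x2 - x1); pose C := x1 * x2 * (y1 - y2).
have conic P : P \in ss -> A * X P * Y P + B * X P + C * Y P = 0.
  move=> Pss; apply: (@conic_lift p m z T0 S0) => //.
  - by split => //; exact: bX.
  - by split => //; exact: bY.
  - exact: rel.
have N0 : B * C != 0.
  by rewrite !mulf_neq0// -oppr_eq0 opprB.
(* [A] times the conic relation reads (A x + C)(A y + B) = B C, and A x + C determines the point
   because [A != 0]. *)
apply: (leq_trans (@size_le_int_divisors _ ss (fun P => A * X P + C) _ N0 us _ _)).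
- move=> P Q Pss Qss /addIr/(mulfI A0) E; apply: Xinj => //.
  apply: zinj; have -> : P.1%:Z - Q.1%:Z = X P - X Q by rewrite /X; ring.
  by rewrite E subrr.
- move=> P Pss; apply/dvdzP; exists (A * Y P + B).
  have := conic P Pss; set x := X P; set y := Y P => E.
  transitivity (B * C + A * (A * x * y + B * x + C * y)); last by ring.
  by rewrite E mulr0 addr0.
rewrite leq_mul2l /=; apply: hD; rewrite absz_gt0 N0 /=.
rewrite -lez_nat abszE !normrM.
have -> : ((m * z) ^ 3)%N%:Z = (m%:Z * z%:Z * m%:Z) * (z%:Z * m%:Z * z%:Z).
  by rewrite -!PoszM; congr Posz; ring.
(* Three of the six factors are at most [m] and three at most [z]. *)
have -> : `|y1| * `|y2| * `|x2 - x1| * (`|x1| * `|x2| * `|y1 - y2|) =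
  (`|x1| * `|y1| * `|x2|) * (`|y2| * `|x1 - x2| * `|y1 - y2|).
  by rewrite [`|x2 - x1|]distrC; ring.
have := ltW bx12; have := ltW by12 => hy hx.
by rewrite !ler_pM ?mulr_ge0.
Qed.

(** * Exponential sums over intervals *)

Definition cis (R : realType) (t : R) : R[i] := cos t +i* sin t.

Lemma cisD (R : realType) (s t : R) : cis (s + t) = cis s * cis t.
Proof. by rewrite /cis cosD sinD; simpc; congr (_ +i* _); ring. Qed.

Lemma cisX (R : realType) (t : R) n : cis (n%:R * t) = cis t ^+ n.
Proof.
elim: n => [|n IH]; first by rewrite mul0r /cis cos0 sin0 expr0.
by rewrite exprS -IH -cisD -natr1; congr cis; ring.
Qed.

Lemma norm_cis (R : realType) (t : R) : `|cis t| = 1.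
Proof. by rewrite normc_def /= cos2Dsin2 sqrtr1. Qed.

Lemma norm_1Bcis (R : realType) (t : R) :
  `|1 - cis (t *+ 2)| = (2 * `|sin t|)%:C.
Proof.
rewrite normc_def /cis cos_mulr2n sin_mulr2n; congr (_%:C).
rewrite [X in Num.sqrt X](_ : _ = (2 * sin t) ^+ 2).
  by rewrite sqrtr_sqr normrM ger0_norm.
have := cos2Dsin2 t; move: (cos t) (sin t) => c s E /=.
have c2 : c ^+ 2 = 1 - s ^+ 2 by rewrite -E; ring.
transitivity ((2 - 2 * c ^+ 2) ^+ 2 + 4 * c ^+ 2 * s ^+ 2); first by ring.
by rewrite c2; ring.
Qed.

(** A weak Jordan inequality. The mean value theorem gives sin(x/2) >= (x/2) cos(x/2), hence sin x
    >= x cos^2(x/2), and cos^2(x/2) = (1 + cos x)/2 >= 1/2. *)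
Lemma half_le_sin (R : realType) (x : R) : 0 <= x <= pi / 2 -> x / 2 <= sin x.
Proof.
move=> /andP[x0 xp].
have pi0 := @pi_gt0 R.
have mvt : x / 2 * cos (x / 2) <= sin (x / 2).
  have y0 : 0 <= x / 2 by lra.
  have [c] := @MVT_segment R sin cos 0 (x / 2) y0
     (fun z _ => is_derive_sin z)
     (continuous_subspaceT (@continuous_sin R)).
  rewrite in_itv/= sin0 !subr0 => /andP[c0 cx] ->.
  rewrite mulrC ler_wpM2r// leNgt ltr_cos ?in_itv/= -?leNgt//; apply/andP; lra.
have Ex : x = (x / 2) *+ 2 by rewrite -mulr_natr divfK// pnatr_eq0.
have -> : sin x = 2 * (cos (x / 2) * sin (x / 2)).
  by rewrite {1}Ex sin_mulr2n mulr_natl.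
have c0 : 0 <= cos (x / 2) by apply: cos_ge0_pihalf; apply/andP; lra.
have cx : 0 <= cos x by apply: cos_ge0_pihalf; apply/andP; lra.
have E : cos x = cos (x / 2) ^+ 2 *+ 2 - 1.
  by rewrite -cos_mulr2n -Ex.
have h1 : 0 <= cos (x / 2) * (sin (x / 2) - x / 2 * cos (x / 2)).
  by rewrite mulr_ge0// subr_ge0.
have h2 : 0 <= x * (cos (x / 2) ^+ 2 *+ 2 - 1) by rewrite -E mulr_ge0.
move: h1 h2; clear; move: (sin (x / 2)) (cos (x / 2)) => s c.
set h1 := c * _; set h2 := x * _ => h10 h20.
have -> : 2 * (c * s) = 2 * h1 + h2 / 2 + x / 2 by rewrite /h1 /h2; field.
lra.
Qed.

(** The additive character e_p, encoded as a power of one p-th root of unity so that additivity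
    becomes reduction of exponents modulo [p]. *)
Definition Fp_char (R : realType) (p : nat) (x : 'F_p) : R[i] :=
  cis (2 * pi / p%:R) ^+ nat_of_ord x.

Lemma ep_Fp_char (R : realType) (p : nat) (x : 'F_p) :
  ep p ((nat_of_ord x)%:R : R) = Fp_char R x.
Proof.
rewrite /ep /cexp /= expR0 mul1r /Fp_char -cisX /cis.
by congr (cos _ +i* sin _); ring.
Qed.

Lemma cis_2piVp (R : realType) (p : nat) : prime p ->
  cis (2 * pi / p%:R : R) ^+ p = 1.
Proof.
move=> pP; rewrite -cisX mulrC divfK ?pnatr_eq0 -?lt0n ?prime_gt0//.
by rewrite mulr_natl /cis cos2pi sin2pi.
Qed.

Lemma Fp_charD (R : realType) (p : nat) (x y : 'F_p) : prime p ->
  Fp_char R (x + y) = Fp_char R x * Fp_char R y.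
Proof.
move=> pP; rewrite /Fp_char -exprD /=.
by rewrite [X in (_ %% X)%N]Fp_cast// expr_mod// cis_2piVp.
Qed.

Lemma norm_Fp_char (R : realType) (p : nat) (x : 'F_p) : `|Fp_char R x| = 1.
Proof. by rewrite normrX norm_cis expr1n. Qed.

Lemma Fp_char0 (R : realType) (p : nat) : Fp_char R (0 : 'F_p) = 1.
Proof. by rewrite /Fp_char expr0. Qed.

Lemma Fp_charMn (R : realType) (p : nat) (x : 'F_p) n : prime p ->
  Fp_char R (n%:R * x) = Fp_char R x ^+ n.
Proof.
move=> pP; elim: n => [|n IH]; first by rewrite mul0r Fp_char0.
by rewrite -natr1 mulrDl mul1r Fp_charD// IH exprSr.
Qed.

Lemma Fp_char_conj (R : realType) (p : nat) (x y : 'F_p) : prime p ->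
  Fp_char R x * (Fp_char R y)^* = Fp_char R (x - y).
Proof.
move=> pP; rewrite -[in LHS](subrK y x) (Fp_charD _ (x - y) y)// -mulrA -normCK.
by rewrite norm_Fp_char expr1n mulr1.
Qed.

Lemma nat_Fp_opp (p : nat) (x : 'F_p) : prime p -> x != 0 ->
  (nat_of_ord (- x) = p - x)%N.
Proof.
move=> pP x0; have x1 : (0 < x)%N.
  by rewrite lt0n; apply: contraNneq x0 => x0; apply/eqP/val_inj.
rewrite /=; move: (nat_of_ord x) x1 => k k0; rewrite Fp_cast// modn_small//.
by have := prime_gt0 pP; lia.
Qed.

(** With t = pi x / p in [0, pi/2], the left-out modulus is 2 sin t >= t, and pi >= 2. *)
Lemma norm_1BFp_char_half (R : realType) (p : nat) (x : 'F_p) : prime p ->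
  (2 * x <= p)%N -> (2 * (x : nat)%:R / p%:R)%:C <= `|1 - Fp_char R x|.
Proof.
move=> pP xp; rewrite /Fp_char -cisX.
have p0 : 0 < p%:R :> R by rewrite ltr0n prime_gt0.
pose t : R := (x : nat)%:R * pi / p%:R.
have -> : (x : nat)%:R * (2 * pi / p%:R) = t *+ 2 by rewrite -mulr_natr /t; ring.
have pi2 := @pi_ge2 R.
have xpR : 2 * (x : nat)%:R <= p%:R :> R by rewrite -natrM ler_nat.
have x0 : 0 <= (x : nat)%:R :> R by [].
rewrite norm_1Bcis lecR -mulrA ler_pM2l//.
apply: le_trans (ler_norm _).
have t1 : 0 <= t <= pi / 2.
  rewrite /t divr_ge0 ?mulr_ge0 ?pi_ge0//= ler_pdivrMr//.
  have := ler_wpM2l (@pi_ge0 R) xpR; lra.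
apply: le_trans (half_le_sin t1).
rewrite (_ : t / 2 = (x : nat)%:R / p%:R * (pi / 2)); last by rewrite /t; ring.
by rewrite ler_peMr ?divr_ge0//; lra.
Qed.

Lemma norm_1BFp_charN (R : realType) (p : nat) (x : 'F_p) : prime p ->
  `|1 - Fp_char R (- x)| = `|1 - Fp_char R x|.
Proof.
move=> pP; rewrite -[LHS]mul1r -{1}(norm_Fp_char R x) -normrM mulrBr mulr1.
by rewrite -Fp_charD// subrr Fp_char0 distrC.
Qed.

(** Multiplying by [1 - z] telescopes the sum to two terms of modulus 1. *)
Lemma norm_geometric_le (R : realType) (z : R[i]) (m n : nat) :
  `|z| = 1 -> z != 1 -> `|\sum_(m <= v < n) z ^+ v| <= 2 / `|1 - z|.
Proof.
move=> z1 zn1.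
have d0 : 0 < `|1 - z| by rewrite normr_gt0 subr_eq0 eq_sym.
have [mn|/ltnW mn] := leqP n m.
  by rewrite big_geq// normr0 divr_ge0.
rewrite ler_pdivlMr// -normrM mulrBr mulr1 mulr_suml.
under [X in _ - X]eq_bigr do rewrite -exprSr.
rewrite -sumrB (telescope_sumr_eq (fun v => - z ^+ v))//; last first.
  by move=> v _; rewrite opprK addrC.
apply: le_trans (ler_normB _ _) _.
by rewrite !normrN !normrX z1 !expr1n.
Qed.

Definition nat_convex (P : pred nat) :=
  forall u v w, (u <= v <= w)%N -> P u -> P w -> P v.

Lemma big_nat_convex (R : nmodType) (P : pred nat) (F : nat -> R) (V : nat) :
  nat_convex P -> exists m n,
  \sum_(1 <= v < V.+1 | P v) F v = \sum_(m <= v < n) F v.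
Proof.
move=> cP; pose Q v := (1 <= v <= V)%N && P v.
have [[v0 Qv0]|nQ] := pselect (exists v, Q v); last first.
  exists 0%N, 0%N; rewrite [RHS]big_geq// big_nat_cond big_pred0// => v.
  by apply/negP => h; apply: nQ; exists v; rewrite /Q -ltnS.
have exQ : exists v, Q v by exists v0.
have ubQ v : Q v -> (v <= V)%N by case/andP => /andP[].
case: (ex_minnP exQ) => m Qm mmin; case: (ex_maxnP exQ ubQ) => n Qn nmax.
exists m, n.+1.
rewrite -big_filter; congr bigop.
(* Both index lists are strictly increasing, so it suffices that they have the same members. *)
apply: (@irr_sorted_eq _ ltn ltn_trans ltnn).
- by apply: sorted_filter; [exact: ltn_trans|exact: iota_ltn_sorted].
- exact: iota_ltn_sorted.
move=> v; rewrite mem_filter !mem_index_iota.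
have [/andP[/andP[m1 mV] Pm] /andP[/andP[n1 nV] Pn]] := (Qm, Qn).
apply/idP/idP => [/andP[Pv v1]|].
  have Qv : Q v by rewrite /Q Pv andbT -ltnS.
  by rewrite mmin// ltnS nmax.
rewrite ltnS => /andP[mv vn].
by rewrite (cP m v n) ?mv//=; lia.
Qed.

(** One of [x] and [- x] has a representative at most p/2, and its term alone bounds the sum; adding
    the other term makes the estimate symmetric and free of cases. *)
Lemma norm_arc_sum_le (R : realType) (p V Z : nat) (x : 'F_p) (P : pred nat) :
  prime p -> (p <= Z * V)%N -> nat_convex P ->
  `|\sum_(1 <= v < V.+1 | P v) Fp_char R x ^+ v| <=
  (2 * V%:R / (x %/ Z).+1%:R + 2 * V%:R / (nat_of_ord (- x) %/ Z).+1%:R)%:C.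
Proof.
move=> pP ZV cP; set S := \sum_(_ <= _ < _ | _) _.
have pos (k : nat) : 0 <= 2 * V%:R / k.+1%:R :> R by rewrite divr_ge0.
have SV : `|S| <= V%:R%:C.
  apply: le_trans (ler_norm_sum _ _ _) _.
  under eq_bigr do rewrite normrX norm_Fp_char expr1n.
  rewrite big_mkcond /=.
  apply: (@le_trans _ _ (\sum_(1 <= v < V.+1) 1)).
    by apply: ler_sum => v _; case: (P v).
  by rewrite sumr_const_nat subn1 /= rmorph_nat.
have half (y : 'F_p) : (y = x \/ y = - x) -> (2 * y <= p)%N ->
    `|S| <= (2 * V%:R / (y %/ Z).+1%:R)%:C.
  move=> yx yp; have [yZ0|yZ] := posnP (y %/ Z).
    rewrite yZ0 divr1; apply: le_trans SV _; rewrite lecR.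
    by rewrite ler_peMl// ler1n.
  have Z0 : (0 < Z)%N by case: (Z) yZ; rewrite ?divn0.
  have p0 : 0 < p%:R :> R by rewrite ltr0n prime_gt0.
  have y0 : (0 < y)%N by apply: leq_trans yZ (leq_div _ _).
  have lb : (2 * (y : nat)%:R / p%:R)%:C <= `|1 - Fp_char R x|.
    have := norm_1BFp_char_half R pP yp.
    by case: yx => ->//; rewrite norm_1BFp_charN.
  have lb0 : 0 < 2 * (y : nat)%:R / p%:R :> R.
    by rewrite divr_gt0// mulr_gt0// ltr0n.
  have zn1 : Fp_char R x != 1.
    apply: contraTneq lb => ->; rewrite subrr normr0 -(rmorph0 (real_complex R)).
    by rewrite lecR -ltNge.
  rewrite /S; have [m [n ->]] := big_nat_convex (fun v => Fp_char R x ^+ v) V cP.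
  apply: le_trans (norm_geometric_le _ _ (norm_Fp_char _ _) zn1) _.
  apply: (@le_trans _ _ (2 / (2 * (y : nat)%:R / p%:R)%:C)).
    by rewrite ler_pM2l// lef_pV2// posrE ?normr_gt0 ?subr_eq0 1?eq_sym// ltcR.
  rewrite -[2 in X in X / _](rmorph_nat (real_complex R)) -fmorphV -rmorphM lecR.
  have yR : 0 < (y : nat)%:R :> R by rewrite ltr0n.
  rewrite (_ : 2 / _ = p%:R / (y : nat)%:R); last by field; rewrite !gt_eqF.
  rewrite ler_pdivrMr// mulrAC ler_pdivlMr ?ltr0n// -!natrM ler_nat.
  (* For q = [y %/ Z] >= 1: p (q + 1) <= Z V * 2 q <= 2 V y. *)
  have := leq_trunc_div y Z.
  move: yZ; set q := (y %/ Z)%N; move: (nat_of_ord y) => k; nia.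
have [x0|x0] := eqVneq x 0.
  apply: le_trans SV _; rewrite lecR x0 oppr0 /= !div0n !divr1.
  have : 0 <= V%:R :> R by []. lra.
have xN := nat_Fp_opp pP x0.
have [xp|xp] := leqP (2 * x) p.
  by apply: le_trans (half x (or_introl erefl) xp) _; rewrite lecR lerDl.
have xp' : (2 * nat_of_ord (- x)%R <= p)%N by rewrite xN; lia.
by apply: le_trans (half (- x) (or_intror erefl) xp') _; rewrite lecR lerDr.
Qed.

(** * The bilinear estimate *)

(** From ln(1 - t) <= -t with t = 1/(n + 2), the increment t is at most ln(n + 2) - ln(n + 1). *)
Lemma harmonic_le (R : realType) (n : nat) :
  \sum_(j < n.+1) (j.+1%:R : R)^-1 <= 1 + ln n.+1%:R.
Proof.
elim: n => [|n IH]; first by rewrite big_ord1 invr1 ln1 addr0.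
rewrite big_ord_recr /=.
have n0 : 0 < n.+2%:R :> R by [].
have : ln (1 + - (n.+2%:R)^-1 : R) <= - (n.+2%:R)^-1.
  by apply: le_ln1Dx; rewrite ltrN2 invf_lt1// ltr1n.
rewrite (_ : 1 - _ = n.+1%:R / n.+2%:R); last first.
  have -> : n.+1%:R = n.+2%:R - 1 :> R by rewrite -[n.+2%:R]natr1 addrK.
  by rewrite mulrBl divff ?gt_eqF// mul1r.
rewrite ln_div ?posrE//; move: IH; move: (\sum_(_ < _) _) (ln _) (ln _) (_^-1).
by move=> S x y t h1 h2; lra.
Qed.

(** Cauchy-Schwarz against the constant 1, by expanding the square and using 2 x y <= x^2 + y^2. *)
Lemma sqr_norm_sum_le (R : realType) (I : Type) (s : seq I) (F : I -> R[i]) :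
  `|\sum_(i <- s) F i| ^+ 2 <= (size s)%:R * \sum_(i <- s) `|F i| ^+ 2.
Proof.
apply: (@le_trans _ _ ((\sum_(i <- s) `|F i|) ^+ 2)).
  by apply: lerXn2r (ler_norm_sum _ _ _); rewrite nnegrE ?sumr_ge0.
rewrite expr2 mulr_suml.
under eq_bigr do rewrite mulr_sumr.
apply: (@le_trans _ _
  (\sum_(i <- s) \sum_(j <- s) ((`|F i| ^+ 2 + `|F j| ^+ 2) / 2))).
  apply: ler_sum => i _; apply: ler_sum => j _.
  rewrite ler_pdivlMr// mulr_natr.
  exact: (real_leif_mean_square_scaled (normr_real _) (normr_real _)).1.
under eq_bigr do
  rewrite -mulr_suml big_split /= big_const_seq iter_addr_0 count_predT.
rewrite -mulr_suml big_split /= sumrMnl big_const_seq iter_addr_0 count_predT.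
by rewrite -mulr2n -[X in X / _]mulr_natr mulfK ?pnatr_eq0// mulr_natl.
Qed.

(** With w = 1/(a u + b) - c, the points (u, w) satisfy (u + b/a)(w + c) = 1/a. Cutting the range of
    u into blocks of length [m] puts those of one arc into [(U %/ m).+1] cells. *)
Lemma arc_count (p U m z D j : nat) (a b c : 'F_p) :
  prime p -> (0 < m)%N -> (0 < z)%N -> (6 * (m * z) ^ 2 < p)%N -> a != 0 ->
  (forall n, (0 < n <= (m * z) ^ 3)%N -> (size (divisors n) <= D)%N) ->
  (\sum_(1 <= u < U.+1 | (a * u%:R + b != 0)%R &&
     (nat_of_ord ((a * u%:R + b)^-1 - c)%R %/ z == j)) 1
     <= (U %/ m).+1 * (2 * D))%N.
Proof.
move=> pP m0 z0 mzp a0 hD.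
set Q := fun u : nat => (a * u%:R + b != 0) &&
     (nat_of_ord ((a * u%:R + b)^-1 - c)%R %/ z == j)%N.
rewrite (partition_big (fun u => inord (u %/ m) : 'I_(U %/ m).+1) xpredT)//=.
apply: (@leq_trans (\sum_(i < (U %/ m).+1) 2 * D)); last first.
  by rewrite sum_nat_const card_ord.
apply: leq_sum => i _.
pose w (u : nat) := nat_of_ord ((a * u%:R + b)^-1 - c).
rewrite big_nat_cond sum1_count -size_filter.
set s := seq.filter _ _.
have -> : size s = size [seq (u, w u) | u <- s] by rewrite size_map.
apply: (@modular_hyperbola_box p m z i j D (b / a) c a^-1) => //.
- by rewrite invr_eq0.
- rewrite map_inj_uniq ?filter_uniq ?iota_uniq//.
  by move=> u v [].
move=> P /mapP[u]; rewrite mem_filter => /andP[/andP[uU /andP[Qu ui]] _] ->.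
move: Qu => /andP[q0 /eqP wj].
split => //=.
- rewrite -(eqP ui) inordK// ltnS leq_div2r//; lia.
rewrite /w natr_Zp subrK.
have -> : u%:R + b / a = a^-1 * (a * u%:R + b).
  by rewrite mulrDr mulKf// [a^-1 * b]mulrC.
by rewrite -mulrA divff// mulr1.
Qed.

Lemma nat_convex_section (R : realType) (C : set (R^o * R^o)) (u : R) :
  convex_set C -> nat_convex (fun v => (u, v%:R) \in C).
Proof.
move=> cC v1 v v2 /andP[h1 h2] C1 C2.
have [v12|v12] := eqVneq v1 v2.
  by have <- : v1 = v by lia.
have d0 : 0 < v2%:R - v1%:R :> R by rewrite subr_gt0 ltr_nat; lia.
(* The weight of [v1] when [v] is written as a convex combination of [v1] and [v2]. *)
pose t : R := (v2%:R - v%:R) / (v2%:R - v1%:R).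
have t0 : 0 <= t by rewrite divr_ge0 ?(ltW d0)// subr_ge0 ler_nat.
have t1 : t <= 1 by rewrite ler_pdivrMr// mul1r lerD2l lerN2 ler_nat.
have := cC _ _ (Itv01 t0 t1) C1 C2.
set X := conv _ _ _; suff -> : X = ((u, v%:R) : R^o * R^o) by [].
rewrite /X; congr pair; rewrite /= /unstable.onem /GRing.scale /=; first by ring.
by rewrite /t; field; rewrite gt_eqF.
Qed.


(** Grouping the u by arc index j, the count is bounded uniformly in j, so the weights 1/(j + 1) add
    up to a harmonic sum. *)
Lemma arc_weight_sum_le (R : realType) (p U m z D : nat) (a b c : 'F_p)
    (W : R) : prime p -> (0 < m)%N -> (0 < z)%N -> (6 * (m * z) ^ 2 < p)%N ->
  a != 0 -> 0 <= W ->
  (forall n, (0 < n <= (m * z) ^ 3)%N -> (size (divisors n) <= D)%N) ->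
  \sum_(1 <= u < U.+1 | a * u%:R + b != 0)
     W / (nat_of_ord ((a * u%:R + b)^-1 - c)%R %/ z).+1%:R
  <= W * (1 + ln p.+1%:R) * ((U %/ m).+1 * (2 * D))%:R.
Proof.
move=> pP m0 z0 mzp a0 W0 hD.
pose w (u : nat) := (nat_of_ord ((a * u%:R + b)^-1 - c)%R %/ z)%N.
have wp u : (w u < p.+1)%N.
  rewrite ltnS; apply: leq_trans (leq_div _ _) _.
  by have := ltn_ord ((a * u%:R + b)^-1 - c)%R; rewrite [X in (_ < X)%N]Fp_cast// => /ltnW.
rewrite (partition_big (fun u => inord (w u) : 'I_p.+1) xpredT)//=.
apply: (@le_trans _ _ (\sum_(j < p.+1)
   W * (j.+1%:R)^-1 * ((U %/ m).+1 * (2 * D))%:R)); last first.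
  rewrite -mulr_suml -mulr_sumr ler_wpM2r// ler_wpM2l//; exact: harmonic_le.
apply: ler_sum => j _.
apply: (@le_trans _ _ (\sum_(1 <= u < U.+1 | (a * u%:R + b != 0)%R &&
     (nat_of_ord ((a * u%:R + b)^-1 - c)%R %/ z == j)%N) W * (j.+1%:R)^-1)).
  rewrite le_eqVlt; apply/orP; left; apply/eqP.
  apply: eq_big => u.
    by congr (_ && _); rewrite -(inj_eq val_inj) /= inordK.
  by move=> /andP[_ /eqP <-]; rewrite inordK.
rewrite big_const_seq iter_addr_0 -[leLHS]mulr_natr ler_wpM2l//.
  by rewrite divr_ge0.
rewrite ler_nat -sum1_count; exact: arc_count.
Qed.

Lemma kloosterman_sqr_le (R : realType) (p U V m z D : nat) (a b : 'F_p)
    (C : set (R^o * R^o)) (alpha beta : nat -> R[i]) :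
  prime p -> (0 < m)%N -> (0 < z)%N -> (6 * (m * z) ^ 2 < p)%N ->
  (p <= z * V)%N -> a != 0 -> convex_set C ->
  (forall u, (1 <= u <= U)%N -> `|alpha u| <= 1) ->
  (forall v, (1 <= v <= V)%N -> `|beta v| <= 1) ->
  (forall n, (0 < n <= (m * z) ^ 3)%N -> (size (divisors n) <= D)%N) ->
  `|kloosterman_sum U V a b C alpha beta| ^+ 2 <=
  (V%:R * (U%:R * (2 * (2 * V%:R * (1 + ln p.+1%:R) *
     ((U %/ m).+1 * (2 * D))%:R))))%:C.
Proof.
move=> pP m0 z0 mzp pzV a0 cC ha hb hD.
pose q (u : nat) := a * u%:R + b != 0.
pose f (u : nat) : 'F_p := (a * u%:R + b)^-1.
pose P (u v : nat) := ((u%:R, v%:R) \in C) && q u.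
pose S (v : nat) : R[i] :=
  \sum_(1 <= u < U.+1 | P u v) alpha u * Fp_char R (f u) ^+ v.
(* With v outermost, Cauchy-Schwarz discards [beta] and leaves the mean square of [S]. *)
have KE : kloosterman_sum U V a b C alpha beta =
    \sum_(1 <= v < V.+1) beta v * S v.
  rewrite /kloosterman_sum.
  under eq_bigr do under eq_bigr do rewrite ep_Fp_char Fp_charMn//.
  rewrite (exchange_big_dep xpredT)//=.
  apply: eq_bigr => v _; rewrite /S mulr_sumr.
  apply: eq_bigr => u _; rewrite mulrA.
  by rewrite [beta v * _]mulrC.
pose T := \sum_(1 <= v < V.+1) `|S v| ^+ 2.
have KT : `|kloosterman_sum U V a b C alpha beta| ^+ 2 <= V%:R * T.
  rewrite KE; apply: le_trans (sqr_norm_sum_le _ _) _.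
  rewrite size_iota subn1 /= ler_wpM2l// ler_sum_nat// => v vV.
  rewrite normrM exprMn ler_piMl ?exprn_ge0// exprn_ile1// hb//.
(* Opening the square and moving v inside: conjugation turns the two characters into one at
   [f u1 - f u2]. *)
have TE : T = \sum_(1 <= u1 < U.+1 | q u1) \sum_(1 <= u2 < U.+1 | q u2)
    alpha u1 * (alpha u2)^* *
    \sum_(1 <= v < V.+1 | P u1 v && P u2 v) Fp_char R (f u1 - f u2) ^+ v.
  transitivity (\sum_(1 <= v < V.+1) \sum_(1 <= u1 < U.+1 | P u1 v)
     \sum_(1 <= u2 < U.+1 | P u2 v)
     alpha u1 * (alpha u2)^* * Fp_char R (f u1 - f u2) ^+ v).
    apply: eq_bigr => v _; rewrite normCK /S rmorph_sum big_distrlr /=.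
    apply: eq_bigr => u1 _; apply: eq_bigr => u2 _.
    by rewrite rmorphM rmorphXn /= mulrACA -exprMn Fp_char_conj.
  rewrite (exchange_big_dep q)/=; last by move=> v u _ /andP[].
  apply: eq_bigr => u1 _.
  rewrite (exchange_big_dep q)/=; last by move=> v u _ /andP[].
  by apply: eq_bigr => u2 _; rewrite mulr_sumr.
pose h (x : 'F_p) : R := 2 * V%:R / (x %/ z).+1%:R.
have TH : T <= (\sum_(1 <= u1 < U.+1 | q u1) \sum_(1 <= u2 < U.+1 | q u2)
    (h (f u1 - f u2) + h (f u2 - f u1)))%:C.
  have T0 : 0 <= T by apply: sumr_ge0 => v _; rewrite exprn_ge0.
  rewrite -(ger0_norm T0) TE rmorph_sum /=.
  apply: le_trans (ler_norm_sum _ _ _) _.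
  rewrite [leLHS]big_nat_cond [leRHS]big_nat_cond.
  apply: ler_sum => u1 /andP[u1U qu1]; rewrite rmorph_sum /=.
  apply: le_trans (ler_norm_sum _ _ _) _.
  rewrite [leLHS]big_nat_cond [leRHS]big_nat_cond.
  apply: ler_sum => u2 /andP[u2U qu2].
  rewrite !normrM norm_conjC -[leRHS]mul1r ler_pM ?mulr_ge0//.
    by rewrite mulr_ile1// ha.
  rewrite /h -[f u2 - f u1]opprB; apply: norm_arc_sum_le => //.
  (* The admissible v form the intersection of two sections of [C], again an interval. *)
  move=> v1 v v2 v12 /andP[/andP[A1 _] /andP[A2 _]] /andP[/andP[B1 _] /andP[B2 _]].
  rewrite /P qu1 qu2 !andbT.
  by rewrite (nat_convex_section cC v12 A1 B1) (nat_convex_section cC v12 A2 B2).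
pose B : R := 2 * V%:R * (1 + ln p.+1%:R) * ((U %/ m).+1 * (2 * D))%:R.
have B0 : 0 <= B.
  by rewrite !mulr_ge0// addr_ge0// ln_ge0// ler1n.
have half : \sum_(1 <= u1 < U.+1 | q u1) \sum_(1 <= u2 < U.+1 | q u2)
    h (f u2 - f u1) <= U%:R * B.
  apply: (@le_trans _ _ (\sum_(1 <= u < U.+1) B)); last first.
    by rewrite sumr_const_nat subn1 mulr_natl.
  rewrite big_mkcond; apply: ler_sum => u _; case: (q u) => //.
  by apply: arc_weight_sum_le => //; rewrite mulr_ge0.
apply: le_trans KT _; rewrite rmorphM rmorph_nat ler_wpM2l//.
apply: le_trans TH _; rewrite lecR.
under eq_bigr do rewrite big_split.
(* Swapping [u1] and [u2] identifies the two sides of 0, so one estimate is used twice. *)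
rewrite big_split /= exchange_big /=; apply: le_trans (lerD half half) _.
by rewrite -/B [leRHS]mulrCA [leRHS]mulr_natl mulr2n.
Qed.

(** * Choice of the box and the bound for a fixed exponent *)

Lemma kloosterman_trivial_le (R : realType) (p U V : nat) (a b : 'F_p)
    (C : set (R^o * R^o)) (alpha beta : nat -> R[i]) :
  (forall u, (1 <= u <= U)%N -> `|alpha u| <= 1) ->
  (forall v, (1 <= v <= V)%N -> `|beta v| <= 1) ->
  `|kloosterman_sum U V a b C alpha beta| <= (U%:R * V%:R : R)%:C.
Proof.
move=> ha hb; rewrite /kloosterman_sum.
under eq_bigr do under eq_bigr do rewrite ep_Fp_char.
apply: le_trans (ler_norm_sum _ _ _) _.
apply: (@le_trans _ _ (\sum_(1 <= u < U.+1) V%:R)); last first.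
  by rewrite sumr_const_nat subn1 rmorphM !rmorph_nat mulr_natl.
apply: ler_sum_nat => u uU; apply: le_trans (ler_norm_sum _ _ _) _.
apply: (@le_trans _ _ (\sum_(1 <= v < V.+1) 1)); last first.
  by rewrite sumr_const_nat subn1.
rewrite big_mkcond; apply: ler_sum_nat => v vV; case: ifP => // _.
by rewrite !normrM norm_Fp_char mulr1 mulr_ile1// ?ha ?hb.
Qed.

(** Here ln(p + 1) <= ln 2 + ln p, and ln p = ln(p^d)/d <= p^d/d. *)
Lemma log_le_powR (R : realType) (d : R) (p : nat) : 0 < d -> (0 < p)%N ->
  1 + ln p.+1%:R <= (2 + d^-1) * p%:R `^ d.
Proof.
move=> d0 p0.
have p1 : 1 <= p%:R :> R by rewrite ler1n.
have q1 : 1 <= p%:R `^ d :> R.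
  by rewrite -[leLHS](powRr0 p%:R) ler_powR// ltW.
have lp : ln p%:R <= d^-1 * p%:R `^ d :> R.
  rewrite -ler_pdivrMl ?invr_gt0// invrK -ln_powR ltW// ln_sublinear//.
  exact: lt_le_trans q1.
have l2 : ln (2 : R) <= 1.
  by have := @le_ln1Dx R 1; rewrite -natr1 => -> //; lra.
have : ln p.+1%:R <= ln 2 + ln p%:R :> R.
  rewrite -lnM ?posrE ?ltr0n// -natrM ler_ln ?posrE ?ltr0n ?muln_gt0//.
  by rewrite ler_nat; lia.
move: lp q1 l2; set x := p%:R `^ d; rewrite mulrDl.
move: (ln p.+1%:R) (ln p%:R) (ln 2) (d^-1 * x) => w1 w2 w3 w4 *; lra.
Qed.

(** Take m = floor(V/(5 P^2)) and z = floor(p/V) + 1 <= 2 p/V. The 5 gives m z <= 2P/5, whence 6 (m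
    z)^2 <= (24/25) P^2 < P^3 = p; the 10 is 5 times the factor 2 lost in the floor. *)
Lemma box_dimensions (R : realType) (p V : nat) (P : R) : 1 <= P ->
  P ^+ 3 = p%:R -> (1 <= V < p)%N -> 5 * P ^+ 2 <= V%:R ->
  exists m z : nat,
  [/\ (0 < m)%N, (0 < z)%N & (p <= z * V)%N] /\
  [/\ (6 * (m * z) ^ 2 < p)%N, ((m * z) ^ 3 <= p)%N &
      V%:R <= 10 * P ^+ 2 * m%:R].
Proof.
move=> P1 P3 /andP[V1 Vp] PV.
have P0 : 0 < P by lra.
have P20 : 0 < P ^+ 2 by rewrite exprn_gt0.
have V0 : 0 < V%:R :> R by rewrite ltr0n.
pose t := V%:R / (5 * P ^+ 2).
have t1 : 1 <= t by rewrite ler_pdivlMr ?mulr_gt0// mul1r.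
pose m := Num.truncn t; pose z := (p %/ V).+1.
have m0 : (0 < m)%N by rewrite truncn_gt0.
have mt : m%:R <= t by rewrite truncn_le// (le_trans _ t1).
have tm : t < m.+1%:R by exact: truncnS_gt.
have pV : (0 < p %/ V)%N by rewrite divn_gt0// ltnW.
have zV : (z * V <= 2 * p)%N.
  by have := leq_trunc_div p V; rewrite /z; nia.
have mz : (m * z)%:R <= 2 / 5 * P.
  have zR : z%:R <= 2 * p%:R / V%:R :> R.
    by rewrite ler_pdivlMr// -!natrM ler_nat.
  rewrite natrM; apply: le_trans (ler_pM _ _ mt zR) _ => //.
  rewrite /t -P3 le_eqVlt; apply/orP; left; apply/eqP; field.
  by rewrite !gt_eqF.
have mz0 : 0 <= (m * z)%:R :> R by [].
exists m, z; split; first by split => //; rewrite ltnW// ltn_ceil.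
split.
- rewrite -(ltr_nat R) natrM natrX -P3.
  apply: (@le_lt_trans _ _ (6 * (2 / 5 * P) ^+ 2)).
    by rewrite ler_wpM2l// lerXn2r// nnegrE// (le_trans _ mz).
  rewrite exprMn [P ^+ 3]exprS.
  have : P ^+ 2 <= P * P ^+ 2 by rewrite ler_peMl// ltW.
  rewrite (_ : 6 * _ = 24 / 25 * P ^+ 2); last by field.
  move: P20; set x := P ^+ 2; set y := P * x => *; lra.
- rewrite -(ler_nat R) natrX -P3 lerXn2r ?nnegrE ?(ltW P0)//; lra.
have : t <= 2 * m%:R.
  apply: le_trans (ltW tm) _.
  by rewrite -natrM ler_nat; lia.
rewrite ler_pdivrMr ?mulr_gt0// => /le_trans; apply.
by rewrite le_eqVlt; apply/orP; left; apply/eqP; ring.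
Qed.

Lemma kloosterman_le (R : realType) (d : R) : 0 < d ->
  exists2 c : R, 0 < c &
  forall p : nat, prime p ->
  forall U V : nat, (1 <= U < p)%N -> (1 <= V < p)%N ->
  forall C : set (R^o * R^o), convex_set C ->
  forall alpha beta : nat -> R[i],
    (forall u, (1 <= u <= U)%N -> `|alpha u| <= 1) ->
    (forall v, (1 <= v <= V)%N -> `|beta v| <= 1) ->
  forall a b : 'F_p, a != 0 ->
  `|kloosterman_sum U V a b C alpha beta| <=
  (c * p%:R `^ d * (U%:R * V%:R `^ (2^-1) * p%:R `^ (3^-1)
      + U%:R `^ (2^-1) * V%:R))%:C.
Proof.
move=> d0; have [c1 c10 hc1] := size_divisors_le d0.
pose c2 := 2 + d^-1; have c20 : 0 < c2 by rewrite addr_gt0// invr_gt0.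
have c12 : 0 < 80 * c1 * c2 by rewrite !mulr_gt0.
(* The 3 pays for the range of small [V], the square root for the bound on the squared sum. *)
exists (3 + Num.sqrt (80 * c1 * c2)).
  by rewrite ltr_wpDr ?sqrtr_ge0.
move=> p pP U V hU hV C cC alpha beta ha hb a b a0.
have p0 : (0 < p)%N := prime_gt0 pP.
have p1 : 1 <= p%:R :> R by rewrite ler1n.
set P : R := p%:R `^ (3^-1).
have P1 : 1 <= P by rewrite -[leLHS](powRr0 p%:R) ler_powR.
have P3 : P ^+ 3 = p%:R.
  by rewrite -powR_mulrn ?powR_ge0// -powRrM mulVf ?pnatr_eq0// powRr1.
set q : R := p%:R `^ d.
have q1 : 1 <= q by rewrite -[leLHS](powRr0 p%:R) ler_powR// ltW.
have q0 : 0 < q by apply: lt_le_trans q1.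
have [U1 Up] := andP hU; have [V1 Vp] := andP hV.
have U0 : 0 < U%:R :> R by rewrite ltr0n.
have V0 : 0 < V%:R :> R by rewrite ltr0n.
rewrite !powR12_sqrt//.
set x : R := Num.sqrt U%:R; set y : R := Num.sqrt V%:R.
have x0 : 0 < x by rewrite sqrtr_gt0.
have y0 : 0 < y by rewrite sqrtr_gt0.
have Ux : U%:R = x ^+ 2 by rewrite sqr_sqrtr// ltW.
have Vy : V%:R = y ^+ 2 by rewrite sqr_sqrtr// ltW.
have s0 := sqrtr_ge0 (80 * c1 * c2).
have A0 : 0 < x ^+ 2 * y * P by rewrite !mulr_gt0 ?exprn_gt0// (lt_le_trans _ P1).
have B0 : 0 < x * y ^+ 2 by rewrite !mulr_gt0 ?exprn_gt0.
(* For small [V] the trivial bound U V suffices, since V^(1/2) <= 3 P there. *)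
have [VP|PV] := ltP V%:R (5 * P ^+ 2).
  apply: le_trans (kloosterman_trivial_le _ _ _ ha hb) _; rewrite lecR.
  rewrite Ux Vy in VP *.
  have yP : y <= 3 * P.
    rewrite -(@ler_pXn2r _ 2)// ?nnegrE ?(ltW y0)//; last by lra.
    rewrite exprMn; have := sqr_ge0 P; move: VP.
    move: (y ^+ 2) (P ^+ 2) => *; lra.
  apply: (@le_trans _ _ (3 * (x ^+ 2 * y * P))).
    rewrite (_ : 3 * _ = x ^+ 2 * y * (3 * P)); last by ring.
    rewrite [leLHS](_ : _ = x ^+ 2 * y * y); last by ring.
    by rewrite ler_wpM2l// mulr_ge0 ?exprn_ge0 ?ltW.
  rewrite ler_pM//; [exact: ltW| |by rewrite lerDl ltW].
  by rewrite -[leLHS]mulr1 ler_pM// lerDl.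
have [m [z [[m0 z0 pzV] [mz2 mz3 Vm]]]] := box_dimensions P1 P3 hV PV.
(* The divisor bound is applied to integers up to [(m * z) ^ 3 <= p], so [q] = p^d dominates their
   d-th powers. *)
pose D := Num.truncn (c1 * q).
have cq0 : 0 <= c1 * q by rewrite mulr_ge0 ?ltW.
have DR : D%:R <= c1 * q by rewrite truncn_le.
have hD n : (0 < n <= (m * z) ^ 3)%N -> (size (divisors n) <= D)%N.
  move=> /andP[n0 nmz]; rewrite truncn_ge_nat//.
  apply: le_trans (hc1 n n0) _; rewrite ler_wpM2l ?(ltW c10)//.
  by rewrite ge0_ler_powR ?nnegrE ?(ltW d0)// ler_nat (leq_trans nmz).
have := kloosterman_sqr_le b pP m0 z0 mz2 pzV a0 cC ha hb hD.
have mR : 0 < m%:R :> R by rewrite ltr0n.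
have L := log_le_powR d0 p0; rewrite -/c2 -/q in L.
have L0 : 0 <= 1 + ln p.+1%:R :> R by rewrite addr_ge0// ln_ge0// ler1n.
have UmR : (U %/ m).+1%:R * V%:R <= 10 * x ^+ 2 * P ^+ 2 + y ^+ 2 :> R.
  rewrite -natr1 mulrDl mul1r -Vy lerD2r -Ux.
  apply: (@le_trans _ _ ((U %/ m)%:R * (10 * P ^+ 2 * m%:R))).
    by rewrite ler_wpM2l.
  rewrite (_ : _ * (_ * m%:R) = 10 * P ^+ 2 * ((U %/ m) * m)%:R); last first.
    by rewrite natrM; ring.
  rewrite (_ : 10 * U%:R * _ = 10 * P ^+ 2 * U%:R); last by ring.
  by rewrite ler_wpM2l ?mulr_ge0 ?exprn_ge0 ?ler_nat ?leq_trunc_div//; lra.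
set K := kloosterman_sum _ _ _ _ _ _ _ => K2.
have : `|K| ^+ 2 <= ((Num.sqrt (80 * c1 * c2) * q *
    (x ^+ 2 * y * P + x * y ^+ 2)) ^+ 2)%:C.
  apply: le_trans K2 _; rewrite lecR.
  rewrite [leRHS](_ : _ = 80 * c1 * c2 * q ^+ 2 *
    (x ^+ 2 * y * P + x * y ^+ 2) ^+ 2); last first.
    by rewrite !exprMn sqr_sqrtr// ltW.
  rewrite [leLHS](_ : _ = 8 * V%:R * U%:R * ((1 + ln p.+1%:R) * D%:R) *
     ((U %/ m).+1%:R * V%:R)); last by rewrite !natrM; ring.
  apply: (@le_trans _ _ (8 * V%:R * U%:R * ((c2 * q) * (c1 * q)) *
     (10 * x ^+ 2 * P ^+ 2 + y ^+ 2))).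
    by rewrite ler_pM// ?mulr_ge0// ler_wpM2l// ?mulr_ge0// ler_pM.
  (* In terms of x = U^(1/2) and y = V^(1/2) the claim is polynomial: 8 x^2 y^2 (10 x^2 P^2 + y^2)
     is at most 80 times the square of x^2 y P + x y^2. *)
  rewrite Ux Vy -subr_ge0.
  rewrite (_ : _ - _ = c1 * c2 * q ^+ 2 * (160 * (x ^+ 2 * y * P) * (x * y ^+ 2)
     + 72 * (x * y ^+ 2) ^+ 2)); last by ring.
  have P0 : 0 <= P by exact: le_trans P1.
  have [c1p qp xp yp] := And4 (ltW c10) (ltW q0) (ltW x0) (ltW y0).
  by rewrite !(mulr_ge0, addr_ge0, exprn_ge0)// invr_ge0 ltW.
have : 0 <= Num.sqrt (80 * c1 * c2) * q * (x ^+ 2 * y * P + x * y ^+ 2).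
  by rewrite mulr_ge0 ?(addr_ge0 (ltW A0) (ltW B0))// mulr_ge0// ltW.
rewrite rmorphXn /= Ux Vy => E0.
rewrite ler_pXn2r// ?nnegrE//; last by rewrite lecR.
move=> /le_trans; apply; rewrite lecR.
rewrite ler_wpM2r ?addr_ge0 ?(ltW A0) ?(ltW B0)// ler_wpM2r ?(ltW q0)//.
by rewrite lerDr.
Qed.

(** * Uniform exponents *)

(** Bounds c(d) p^d for every d > 0 merge into one exponent: the supremum of ln r / ln p over [X p]
    is at most d + ln(1 + c(d)) / ln p, which falls below any positive number. *)
Lemma subpower_exponent (R : realType) (X : nat -> set R) :
  (forall d : R, 0 < d -> exists2 c : R, 0 < c &
     forall p r, (1 < p)%N -> X p r -> r <= c * p%:R `^ d) ->
  exists2 eps : nat -> R, eps n @[n --> \oo] --> (0 : R) &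
    forall p r, (1 < p)%N -> X p r -> r <= p%:R `^ eps p.
Proof.
move=> hX.
(* Adjoining 0 keeps the set nonempty and its supremum nonnegative. *)
pose Y p : set R := [set e | e = 0 \/
   exists2 r, X p r /\ 0 < r & e = ln r / ln p%:R].
have lnp p : (1 < p)%N -> 0 < ln p%:R :> R by move=> p1; rewrite ln_gt0// ltr1n.
have ubY d : 0 < d -> exists2 c : R, 0 <= c &
    forall p, (1 < p)%N -> ubound (Y p) (d + c / ln p%:R).
  move=> d0; have [c c0 hc] := hX d d0.
  (* Replacing c by 1 + c keeps the logarithm nonnegative. *)
  have c1 : 0 <= ln (1 + c) by rewrite ln_ge0// lerDl ltW.
  exists (ln (1 + c)) => // p p1 e [->|[r [Xr r0] ->]].
    by rewrite addr_ge0 ?(ltW d0)// divr_ge0// ltW// lnp.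
  have p0 : 0 < p%:R :> R by rewrite ltr0n ltnW.
  rewrite ler_pdivrMr ?lnp// mulrDl divfK ?gt_eqF ?lnp//.
  rewrite -ln_powR addrC -lnM ?posrE ?powR_gt0 ?addr_gt0//.
  rewrite ler_ln ?posrE ?mulr_gt0 ?powR_gt0 ?addr_gt0//.
  apply: le_trans (hc _ _ p1 Xr) _.
  by rewrite ler_wpM2r ?powR_ge0// lerDr.
have supY p : (1 < p)%N -> has_sup (Y p).
  move=> p1; split; first by exists 0; left.
  by have [c _ /(_ p p1) h] := ubY 1 ltr01; exists (1 + c / ln p%:R).
exists (fun p => sup (Y p)); last first.
  move=> p r p1 Xr; have p0 : 0 < p%:R :> R by rewrite ltr0n ltnW.
  have [r0|r0] := leP r 0; first exact: le_trans (powR_ge0 _ _).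
  rewrite -ler_ln ?posrE ?powR_gt0// ln_powR -ler_pdivrMr ?lnp//.
  by apply: sup_upper_bound; [exact: supY|right; exists r].
apply/cvgrPdist_le => e e0.
have [c c0 hc] := ubY (e / 2) (divr_gt0 e0 (ltr0n _ 2)).
(* Past exp(2 c/e) the term c / ln p is at most e/2; the extra successor ensures [1 < p]. *)
exists (Num.truncn (expR (2 * c / e))).+2 => // p /= Np.
have p1 : (1 < p)%N by apply: leq_trans Np.
have s0 : 0 <= sup (Y p) by apply: sup_upper_bound; [exact: supY|left].
rewrite sub0r normrN ger0_norm//; apply: sup_le_ub.
  by exists 0; left.
move=> f /(hc p p1) /le_trans; apply.
have : 2 * c / e <= ln p%:R.
  rewrite -[leLHS]expRK ler_ln ?posrE ?expR_gt0 ?ltr0n ?(ltnW p1)//.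
  apply/ltW/(lt_le_trans (truncnS_gt _)).
  by rewrite ler_nat ltnW.
rewrite ler_pdivrMr// => h.
have : c / ln p%:R <= e / 2.
  by rewrite ler_pdivrMr ?lnp// mulrAC ler_pdivlMr// mulrC [e * _]mulrC.
by move=> h2; lra.
Qed.

Theorem theorem2p5 (R : realType) :
  exists eps1 eps2 : nat -> R,
    [/\ eps1 n @[n --> \oo] --> (0 : R),
        eps2 n @[n --> \oo] --> (0 : R) &
        forall p : nat, prime p ->
        forall U V : nat, (1 <= U < p)%N -> (1 <= V < p)%N ->
        forall C : set (R^o * R^o),
          C `<=` `[1, U%:R] `*` `[1, V%:R] -> convex_set C ->
        forall alpha beta : nat -> R[i],
          (forall u, (1 <= u <= U)%N -> `|alpha u| <= 1) ->
          (forall v, (1 <= v <= V)%N -> `|beta v| <= 1) ->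
        forall a b : 'F_p, a != 0 ->
          `|kloosterman_sum U V a b C alpha beta| <=
          (U%:R * V%:R `^ (2^-1) * p%:R `^ (3^-1 + eps1 p)
           + U%:R `^ (2^-1) * V%:R * p%:R `^ (eps2 p))%:C ].
Proof.
pose bd (p U V : nat) : R :=
  U%:R * V%:R `^ (2^-1) * p%:R `^ (3^-1) + U%:R `^ (2^-1) * V%:R.
have bd0 p U V : (1 < p)%N -> (1 <= U)%N -> (1 <= V)%N -> 0 < bd p U V.
  move=> p1 U1 V1.
  by rewrite addr_gt0// !mulr_gt0 ?powR_gt0 ?ltr0n// ltnW.
(* All ratios of the sum to its bound, over every choice of data at the prime [p]: a single exponent
   for this set is uniform, and it serves both terms. *)
pose X (p : nat) : set R := [set r | prime p /\
  exists U V C alpha beta (a b : 'F_p),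
  [/\ (1 <= U < p)%N, (1 <= V < p)%N, @convex_set R (R^o * R^o)%type C & a != 0] /\
  [/\ (forall u, (1 <= u <= U)%N -> `|alpha u| <= 1),
      (forall v, (1 <= v <= V)%N -> `|beta v| <= 1) &
      `|kloosterman_sum U V a b C alpha beta| = (r * bd p U V)%:C]].
have [|eps eps0 heps] := @subpower_exponent R X.
  move=> d d0; have [c c0 hc] := kloosterman_le d0; exists c => // p r p1.
  move=> [pP [U [V [C [alpha [beta [a [b [[hU hV cC a0] [ha hb E]]]]]]]]]].
  have := hc p pP U V hU hV C cC alpha beta ha hb a b a0.
  rewrite E lecR ler_pM2r// bd0//; [by case/andP: hU|by case/andP: hV].
exists eps, eps; split => // p pP U V hU hV C _ cC alpha beta ha hb a b a0.
have p1 := prime_gt1 pP.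
have B0 : 0 < bd p U V by rewrite bd0//; [case/andP: hU|case/andP: hV].
set K := kloosterman_sum _ _ _ _ _ _ _.
(* The norm on [R[i]] takes values in [R[i]]; [k] is the same modulus as a real number. *)
pose k : R := Num.sqrt (complex.Re K ^+ 2 + complex.Im K ^+ 2).
have Kk : `|K| = k%:C by rewrite normc_def.
have /heps -/(_ p1) : X p (k / bd p U V).
  split => //; exists U, V, C, alpha, beta, a, b; split => //; split => //.
  by rewrite divfK// gt_eqF.
rewrite ler_pdivrMr// Kk lecR => /le_trans; apply.
rewrite powRD ?pnatr_eq0 -?lt0n ?prime_gt0 ?implybT//.
by rewrite /bd mulrDr mulrC le_eqVlt; apply/orP; left; apply/eqP; ring.
Qed.
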